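(* Let $F$ be a face of $\mathcal P_\Phi$. The set $V_F=\Phi\cap F$ of the roots in $F$ is not the union of two nonempty subsets $V_1,V_2$ such that every root in $V_1$ is orthogonal to every root in $V_2$.
   Context: $\Phi$ is a finite irreducible reduced crystallographic root system in the Euclidean space $\mathrm{Span}_{\mathbb R}\Phi$ with scalar product $(\cdot,\cdot)$. $\mathcal P_\Phi$ is the convex hull of $\Phi$. Faces are nonempty. *)

(* Defs.v *)
From HB Require Import structures.
From mathcomp Require Import all_boot all_order all_algebra finmap.
From mathcomp Require Import mathcomp_extra boolp classical_sets reals convex.

Set Implicit Arguments.
Unset Strict Implicit.
Unset Printing Implicit Defensive.

Import Order.TTheory GRing.Theory Num.Theory.

Local Open Scope classical_set_scope.
Local Open Scope ring_scope.

Section RootSystems.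
Variables (R : realType) (V : vectType R) (dot : {dot V for @idfun R}).
Implicit Types (A : set V) (Phi : {fset V}) (a b : V).

(* 2 (b, a) / (a, a), the coefficient of a in b - s_a(b). *)
Definition cartan_int a b : R := 2 * dot b a / dot a a.

Definition reflection a b : V := b - cartan_int a b *: a.

(* The inclusion s_a(Phi) <= Phi is equivalent to s_a(Phi) = Phi, since s_a is
   an involution. The ambient space V is Span Phi. *)
Definition root_system Phi : Prop :=
  [/\ <<enum_fset Phi>>%VS = fullv,
      0 \notin Phi
    & {in Phi &, forall a b, reflection a b \in Phi}].

Definition crystallographic Phi : Prop :=
  {in Phi &, forall a b, cartan_int a b \is a Num.int}.

Definition reduced Phi : Prop :=
  {in Phi, forall a (c : R), c *: a \in Phi -> c = 1 \/ c = - 1}.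

(* The parts need not be assumed disjoint: an element of both would be
   orthogonal to itself, hence zero. *)
Definition orthogonal_union A : Prop :=
  exists A1 A2 : set V,
    [/\ A1 !=set0, A2 !=set0, A = A1 `|` A2
      & forall a b, A1 a -> A2 b -> dot a b = 0].

Definition irreducible Phi : Prop :=
  [set` Phi] !=set0 /\ ~ orthogonal_union [set` Phi].

End RootSystems.

Section Polytopes.
Variables (R : realType) (V : vectType R).
Implicit Types (A P F : set V).

Definition convex_hull A : set V := smallest (@convex_set R V) A.

(* The linear form f = 0 with c = 0 makes P itself a face; the empty set is
   not a face. *)
Definition face P F : Prop :=
  F !=set0 /\
  exists (f : {scalar V}) (c : R),
    (forall x, P x -> f x <= c) /\ F = P `&` [set x | f x = c].

End Polytopes.

Definition root_polytope (R : realType) (V : vectType R) (Phi : {fset V}) :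
  set V := convex_hull [set` Phi].

(* Main.v *)
Require Import Defs.
From HB Require Import structures.
From mathcomp Require Import all_boot all_order all_algebra finmap.
From mathcomp Require Import mathcomp_extra boolp classical_sets reals convex.
From mathcomp Require Import lra.

Set Implicit Arguments.
Unset Strict Implicit.
Unset Printing Implicit Defensive.

Import Order.TTheory GRing.Theory Num.Theory.

Local Open Scope classical_set_scope.
Local Open Scope ring_scope.

(* Let f <= c on Phi with equality exactly on V_F, and let a in V_1, b in V_2.
   By irreducibility some root g is orthogonal to neither a nor b; replacing g
   by -g and then by s_b(g) makes (g, a) and (g, b) positive. Then a - g and
   a - g + b are roots (or g = a + b), so 2 c - f(g) <= c and g lies in the
   face. But then g is in V_1 or in V_2, hence orthogonal to b or to a. *)

Section DotProduct.
Variables (R : realType) (V : vectType R) (dot : {dot V for @idfun R}).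
Implicit Types a b x : V.

Lemma dotC a b : dot a b = dot b a.
Proof. by rewrite hermC expr0 mul1r. Qed.

Lemma dot_gt0 a : a != 0 -> 0 < dot a a.
Proof. exact: neq0_dnorm_gt0. Qed.

Lemma dot_reflectionr a b x :
  dot x (reflection dot a b) = dot x b - cartan_int dot a b * dot x a.
Proof. by rewrite /reflection linearBr linearZr_LR. Qed.

Lemma reflection_id a : a != 0 -> reflection dot a a = - a.
Proof.
move=> /dot_gt0 /lt0r_neq0 an0.
by rewrite /reflection /cartan_int mulfK // scaler_nat mulr2n opprD addNKr.
Qed.

End DotProduct.

Lemma int_gt0_eq1_or_ge2 (R : archiRealDomainType) (x : R) :
  x \is a Num.int -> 0 < x -> x = 1 \/ 2 <= x.
Proof.
move=> /intrP[[[|[|n]]|n] ->]; rewrite ?ltxx ?ltr0z //; first by left.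
by right; rewrite (ler_nat R 2).
Qed.

Section RootSystem.
Variables (R : realType) (V : vectType R) (dot : {dot V for @idfun R}).
Variables (Phi : {fset V}) (Phi_root : root_system dot Phi).
Implicit Types a b g : V.

Lemma root_neq0 a : a \in Phi -> a != 0.
Proof. by case: Phi_root => _ n0 _ aP; apply: contraNneq n0 => <-. Qed.

Lemma root_reflection a b :
  a \in Phi -> b \in Phi -> reflection dot a b \in Phi.
Proof. by case: Phi_root => _ _; apply. Qed.

Lemma rootN a : a \in Phi -> - a \in Phi.
Proof.
by move=> aP; rewrite -(reflection_id dot (root_neq0 aP)) root_reflection.
Qed.

(** Both Cartan integers of [a] and [b] are positive. If one of them equals 1, the corresponding
    reflection sends one root to [a - b] or to [b - a]. *)
Lemma rootB a b : crystallographic dot Phi ->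
  a \in Phi -> b \in Phi -> 0 < dot a b -> a = b \/ a - b \in Phi.
Proof.
move=> crys aP bP ab0.
have aa0 := dot_gt0 dot (root_neq0 aP).
have bb0 := dot_gt0 dot (root_neq0 bP).
have ba0 : 0 < dot b a by rewrite dotC.
have pgt0 : 0 < cartan_int dot b a by rewrite divr_gt0 // mulr_gt0.
have qgt0 : 0 < cartan_int dot a b by rewrite divr_gt0 // mulr_gt0.
case: (int_gt0_eq1_or_ge2 (crys b a bP aP) pgt0) => [p1|p2].
  by right; have := root_reflection bP aP; rewrite /reflection p1 scale1r.
case: (int_gt0_eq1_or_ge2 (crys a b aP bP) qgt0) => [q1|q2].
  right; have := rootN (root_reflection aP bP).
  by rewrite /reflection q1 scale1r opprB.
(* Both Cartan integers are at least 2, which forces |a - b|^2 <= 0. *)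
left; move: p2 q2; rewrite /cartan_int !ler_pdivlMr // (dotC dot b a).
move=> p2 q2; apply: contrapT => /eqP; rewrite -subr_eq0 => /(dot_gt0 dot).
rewrite linearBr !linearBl /= (dotC dot b a); lra.
Qed.

Lemma irreducible_link a b : irreducible dot Phi ->
  a \in Phi -> b \in Phi ->
  exists g, [/\ g \in Phi, dot g a != 0 & dot g b != 0].
Proof.
move=> [_ irr] aP bP; apply: contrapT => nlink; apply: irr.
(* [L] holds the vectors joined to [a] by a root. If [b] is not in it, the roots inside and outside
   [L] split [Phi] into two nonempty orthogonal parts. *)
pose L := [set x | exists g, [/\ g \in Phi, dot g a != 0 & dot g x != 0]].
exists ([set` Phi] `&` L), ([set` Phi] `&` ~` L); split.
- exists a; split=> //; exists a.
  by rewrite aP; have /lt0r_neq0 := dot_gt0 dot (root_neq0 aP).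
- by exists b.
- by rewrite -setIUr setUv setIT.
move=> x y [/= xP [g [gP ga gx]]] [/= yP nLy].
apply: contrapT => /eqP xy; apply: nLy.
have [gy|gy] := eqVneq (dot g y) 0; last by exists g.
have [xa|xa] := eqVneq (dot x a) 0; last by exists x.
(* Now [g] is orthogonal to [y] and [x] to [a]. Reflecting [g] in [x] keeps its product with [a] and
   adds a nonzero multiple of [x], which is not orthogonal to [y]. *)
exists (reflection dot x g); split; first exact: root_reflection.
  by rewrite dotC dot_reflectionr (dotC dot a x) xa mulr0 subr0 dotC.
rewrite dotC dot_reflectionr dotC gy sub0r oppr_eq0 mulf_neq0 //.
  have xx := lt0r_neq0 (dot_gt0 dot (root_neq0 xP)).
  by rewrite /cartan_int !mulf_eq0 invr_eq0 pnatr_eq0 /= negb_or gx.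
by rewrite dotC.
Qed.

Lemma irreducible_link_gt0 a b : irreducible dot Phi ->
  a \in Phi -> b \in Phi -> dot a b = 0 ->
  exists g, [/\ g \in Phi, 0 < dot a g & 0 < dot b g].
Proof.
move=> irr aP bP ab0.
have [g [gP ag bg]] : exists g, [/\ g \in Phi, 0 < dot a g & dot b g != 0].
  have [g [gP]] := irreducible_link irr aP bP.
  rewrite !(dotC dot g); case: ltgtP => // ag _ bg; last by exists g.
  by exists (- g); rewrite rootN // !linearNr oppr_gt0 oppr_eq0.
move: bg; case: ltgtP => // bg _; last by exists g.
(* As [a] is orthogonal to [b], this reflection keeps the product with [a] and negates the product
   with [b]. *)
exists (reflection dot b g); split; first exact: root_reflection.
  by rewrite dot_reflectionr ab0 mulr0 subr0.
have bb := lt0r_neq0 (dot_gt0 dot (root_neq0 bP)).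
rewrite dot_reflectionr /cartan_int divfK // (dotC dot g); lra.
Qed.

Lemma max_root_link (f : {scalar V}) (c : R) a b g :
  crystallographic dot Phi -> {in Phi, forall x, f x <= c} ->
  a \in Phi -> b \in Phi -> g \in Phi ->
  f a = c -> f b = c -> dot a b = 0 -> 0 < dot a g -> 0 < dot b g -> f g = c.
Proof.
move=> crys fle aP bP gP fa fb ab0 ag bg.
have fg := fle _ gP; apply: le_anti; rewrite fg /=.
have [agE|agP] := rootB crys aP gP ag.
  by rewrite -agE fa.
(* Orthogonality of [a] and [b] gives [g - a] the same product with [b] as [g], so [rootB] applies a
   second time. *)
have : 0 < dot b (- (a - g)).
  by rewrite opprB linearBr /= (dotC dot b a) ab0 subr0.
case/(rootB crys bP (rootN agP)) => [bE|].
  (* Degenerate case [g = a + b]: then [f g] is twice [c], and [c] is nonnegative because the root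
     [- a] obeys the bound too. *)
  have := fle _ (rootN aP); rewrite raddfN /= fa.
  by move: fb; rewrite bE raddfN raddfB /= fa; lra.
by move/fle; rewrite raddfB raddfN raddfB /= fa fb; lra.
Qed.

End RootSystem.

Lemma sub_convex_hull (R : realType) (V : vectType R) (A : set V) :
  A `<=` convex_hull A.
Proof. exact: sub_gen_smallest. Qed.

Unset Implicit Arguments.

Theorem theorem5p2 (R : realType) (V : vectType R) (dot : {dot V for @idfun R})
    (Phi : {fset V})
    (Phi_root : root_system dot Phi)
    (Phi_crys : crystallographic dot Phi)
    (Phi_red : reduced Phi)
    (Phi_irr : irreducible dot Phi)
    (F : set V) (F_face : face (root_polytope Phi) F) :
  ~ orthogonal_union dot ([set` Phi] `&` F).
Proof.
case: F_face => _ [f [c [fle FE]]] [A1 [A2 [[a A1a] [b A2b] AE orth]]].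
have hullP x : x \in Phi -> root_polytope Phi x by move=> xP; apply: sub_convex_hull.
(* Every root lies in the polytope, so the roots of the face are exactly those where [f] attains
   [c]. *)
have faceP x : A1 x \/ A2 x <-> x \in Phi /\ f x = c.
  have -> : (A1 x \/ A2 x) = (A1 `|` A2) x by [].
  rewrite -AE FE; split=> [[xP [_ fx]] //|[xP fx]].
  by split=> //; split=> //; exact: hullP.
have [aP fa] := (faceP a).1 (or_introl A1a).
have [bP fb] := (faceP b).1 (or_intror A2b).
have ab0 := orth a b A1a A2b.
have [g [gP ag bg]] := irreducible_link_gt0 Phi_root Phi_irr aP bP ab0.
have fg : f g = c.
  apply: (max_root_link Phi_root (a := a) (b := b)) => // x xP.
  by apply: fle; apply: hullP.
(* In [A1], [g] would be orthogonal to [b]; in [A2], to [a]. Both products are positive. *)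
have [A1g|A2g] := (faceP g).2 (conj gP fg).
  by move: bg; rewrite dotC orth ?ltxx.
by move: ag; rewrite orth ?ltxx.
Qed.
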